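(* Let $\mathcal{P}$ be an $(\alpha,\beta)$-rigid linkage of order $t$ in a graph $G$, and let $A\in\mathcal{S}(G)$. Then $\operatorname{null}(A(V(\mathcal{P})))\ge\operatorname{null}(A)-t$.
   Context: $G$ is a simple graph on vertex set $\{1,\dots,n\}$. $\mathcal{S}(G)$ is the set of real symmetric $n\times n$ matrices $A=[a_{ij}]$ with $a_{ij}\ne0$ if $ij\in E(G)$ and $a_{ij}=0$ if $i\ne j$ and $ij\notin E(G)$ (diagonal unrestricted). For $\gamma\subseteq\{1,\dots,n\}$, $A(\gamma)$ is the principal submatrix obtained by deleting rows and columns indexed by $\gamma$. A linkage in $G$ is a subgraph whose components are paths (a single vertex counts as a path); its order is the number of paths; $V(\mathcal{P})$ is its vertex set. For $\alpha,\beta\subseteq V(G)$, $\mathcal{P}$ is an $(\alpha,\beta)$-linkage if $\alpha$ consists of one endpoint of each path and $\beta$ of the other endpoints (a one-vertex path has its vertex in both), and it is $(\alpha,\beta)$-rigid if it is the unique $(\alpha,\beta)$-linkage in $G$. *)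

(* Defs.v *)
From HB Require Import structures.
From mathcomp Require Import all_boot all_order all_algebra.
From mathcomp Require Import reals.

Set Implicit Arguments.
Unset Strict Implicit.
Unset Printing Implicit Defensive.

Import GRing.Theory Num.Theory.

Record sgraph (T : finType) := SGraph {
  adj : rel T;
  adj_sym : symmetric adj;
  adj_irr : irreflexive adj }.

(* A bare pair of a vertex set and an edge set (edges are unordered pairs), so
   that equality of two subgraphs is plain equality. Being a subgraph of G is
   the separate predicate subgraph_of. *)
Record subgraph (T : finType) := Subgraph {
  verts : {set T};
  edges : {set {set T}} }.

Section Linkages.
Variable T : finType.
Implicit Types (G : sgraph T) (H P : subgraph T) (alpha beta C : {set T}).

Definition subgraph_of G H : Prop :=
  forall E, E \in edges H ->
  exists x y, [/\ adj G x y, x \in verts H, y \in verts H & E = [set x; y]].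

Definition sub_adj H : rel T := fun x y => [set x; y] \in edges H.

(* The vertex sets of the connected components of H. *)
Definition components H : {set {set T}} :=
  [set [set y | connect (sub_adj H) x y] | x in verts H].

Definition induced H C : subgraph T :=
  Subgraph (verts H :&: C) [set E in edges H | E \subset C].

(* zip truncates: zip (x :: p) p lists the pairs of consecutive vertices. *)
Definition path_graph (x : T) (p : seq T) : subgraph T :=
  Subgraph [set z in x :: p] [set [set w.1; w.2] | w in zip (x :: p) p].

Definition path_between (x y : T) H : Prop :=
  exists p : seq T, [/\ uniq (x :: p), last x p = y & H = path_graph x p].

Definition linkage G H : Prop :=
  subgraph_of G H /\
  forall C, C \in components H -> exists x y, path_between x y (induced H C).

Definition linkage_order H : nat := #|components H|.

Definition ab_linkage G alpha beta H : Prop :=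
  [/\ linkage G H, alpha \subset verts H, beta \subset verts H &
      forall C, C \in components H ->
      exists x y, [/\ path_between x y (induced H C),
                      alpha :&: C = [set x] & beta :&: C = [set y]]].

Definition ab_rigid G alpha beta P : Prop :=
  ab_linkage G alpha beta P /\ forall Q, ab_linkage G alpha beta Q -> Q = P.

End Linkages.

Local Open Scope ring_scope.

Definition matrices_of_graph (R : realType) (n : nat) (G : sgraph 'I_n)
    (A : 'M[R]_n) : Prop :=
  A^T = A /\ forall i j : 'I_n, i != j -> (A i j != 0) = adj G i j.

Definition principal_del (R : realType) (n : nat) (A : 'M[R]_n)
    (gamma : {set 'I_n}) : 'M[R]_#|~: gamma| :=
  mxsub (@enum_val _ (mem (~: gamma))) (@enum_val _ (mem (~: gamma))) A.

(* The column space of cokermx A is the null space {v | A *m v = 0}. *)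
Definition nullity (R : realType) (n : nat) (A : 'M[R]_n) : nat :=
  \rank (cokermx A).

(* Main.v *)
(* Let W = V(P). As A(W) is symmetric, it has a nonsingular principal submatrix
   A[S] of order r = rank A(W). Let tau move every vertex of W one step along
   its path in P and send the end in beta back to the start in alpha. Replace
   in A each row b of beta by the unit row of tau b, and each row i outside
   W and S by the unit row of i, to get B. A permutation sg contributing to
   det B agrees with tau on beta, so its orbits, cut after the vertices of beta,
   form an (alpha, beta)-linkage together with cycles and fixed points; by
   rigidity that linkage is P and sg agrees with tau on W. Hence det B equals
   the determinant of a matrix B' that is monomial on W and block triangular
   with diagonal blocks A[S] and an identity elsewhere, so B is invertible. As
   A and B differ in at most t + (n - |W| - r) rows, rank A >= |W| + r - t. *)

Require Import Defs.
From HB Require Import structures.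
From mathcomp Require Import all_boot all_order all_algebra.
From mathcomp Require Import reals perm zify.

Set Implicit Arguments.
Unset Strict Implicit.
Unset Printing Implicit Defensive.

(** * Linkages built from disjoint vertex sequences and from permutations *)

Lemma edges_path_graphP (T : finType) (x : T) (p : seq T) (E : {set T}) :
  reflect (exists2 k, k < size p &
             E = [set nth x (x :: p) k; nth x (x :: p) k.+1])
          (E \in edges (path_graph x p)).
Proof.
have sz_zip : size (zip (x :: p) p) = size p by rewrite size_zip /=; lia.
apply: (iffP imsetP) => [[w /(nthP (x, x))[k]]|[k ltk ->]].
  rewrite sz_zip => ltk; rewrite nth_zip_cond sz_zip ltk => <- ->.
  by exists k.
exists (nth (x, x) (zip (x :: p) p) k); first by rewrite mem_nth ?sz_zip.
by rewrite nth_zip_cond sz_zip ltk.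
Qed.

Lemma edges_path_graph_sub (T : finType) (x : T) (p : seq T) (E : {set T}) :
  E \in edges (path_graph x p) -> E \subset [set z in x :: p].
Proof.
case/edges_path_graphP => k ltk ->; apply/subsetP => z.
by rewrite !inE -in_cons => /orP[] /eqP->; rewrite mem_nth //=; lia.
Qed.

Lemma sub_adj_sym (T : finType) (H : subgraph T) : symmetric (sub_adj H).
Proof. by move=> x y; rewrite /sub_adj setUC. Qed.

Section PathFamily.
Variables (T : finType) (G : sgraph T) (alpha beta : {set T}) (p : T -> seq T).

Definition path_family : subgraph T :=
  Subgraph [set x | [exists a in alpha, x \in a :: p a]]
           [set E | [exists a in alpha, E \in edges (path_graph a (p a))]].

Hypothesis p_uniq : forall a, a \in alpha -> uniq (a :: p a).
Hypothesis p_path : forall a, a \in alpha -> path (adj G) a (p a).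
Hypothesis p_disj : forall a a' x, a \in alpha -> a' \in alpha ->
  x \in a :: p a -> x \in a' :: p a' -> a = a'.
Hypothesis p_end : forall a, a \in alpha -> last a (p a) \in beta.
Hypothesis p_beta : forall a b, a \in alpha -> b \in beta ->
  b \in a :: p a -> b = last a (p a).
Hypothesis beta_cover : forall b, b \in beta ->
  exists2 a, a \in alpha & b \in a :: p a.

(** Every edge of the family joins consecutive entries of one sequence [a :: p a]. By [p_disj] a
    vertex determines its sequence, so a walk never leaves the one in which it starts. *)
Lemma path_family_component (a x : T) : a \in alpha -> x \in a :: p a ->
  [set y | connect (sub_adj path_family) x y] = [set z in a :: p a].
Proof.
move=> aA xa.
have conn_a y : y \in a :: p a -> connect (sub_adj path_family) a y.
  apply: path_connect; apply/(pathP a) => i lti.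
  rewrite /sub_adj inE; apply/exists_inP; exists a => //.
  by apply/edges_path_graphP; exists i.
apply/setP=> y; rewrite !inE -in_cons; apply/idP/idP.
  case/connectP=> q + ->; elim: q x xa => //= z q IH x xa /andP[xz /IH]; apply.
  move: xz; rewrite /sub_adj inE => /exists_inP[a' a'A /edges_path_graph_sub].
  rewrite subUset !sub1set !inE -!in_cons => /andP[xa' za'].
  by rewrite (p_disj aA a'A xa xa').
move=> ya; apply: (@connect_trans _ _ a); last exact: conn_a.
by rewrite (sym_connect_sym (@sub_adj_sym _ _)); apply: conn_a.
Qed.

(** An edge inside [a :: p a] that comes from the sequence of [a'] has a vertex in both, so [p_disj]
    forces [a' = a]. *)
Lemma induced_path_family (a : T) : a \in alpha ->
  induced path_family [set z in a :: p a] = path_graph a (p a).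
Proof.
move=> aA; rewrite /induced; congr Subgraph; apply/setP=> E.
  rewrite !inE -!in_cons; case: (boolP (E \in a :: p a)) => Ea;
    rewrite ?andbF ?andbT //.
  by apply/exists_inP; exists a.
rewrite inE [E \in edges path_family]inE /=.
apply/andP/idP => [[/exists_inP[a' a'A Ea'] sEa]|Ea].
  have [k ltk Ek] := edges_path_graphP _ _ _ Ea'.
  have kE : nth a' (a' :: p a') k \in E by rewrite Ek !inE eqxx.
  have := subsetP (edges_path_graph_sub Ea') _ kE; have := subsetP sEa _ kE.
  by rewrite !inE => ka ka'; rewrite (p_disj aA a'A ka) // in_cons.
split; last exact: edges_path_graph_sub.
by apply/exists_inP; exists a.
Qed.

Lemma path_family_linkage : ab_linkage G alpha beta path_family.
Proof.
have compP C : C \in components path_family ->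
    exists2 a, a \in alpha & C = [set z in a :: p a].
  case/imsetP=> x; rewrite inE => /exists_inP[a aA xa] ->.
  by exists a => //; apply: path_family_component.
have btw C : C \in components path_family -> exists x y,
    [/\ path_between x y (induced path_family C), alpha :&: C = [set x] &
        beta :&: C = [set y]].
  case/compP=> a aA ->; exists a, (last a (p a)); split.
  - by exists (p a); rewrite induced_path_family ?p_uniq.
  - apply/setP=> z; rewrite !inE -in_cons; apply/andP/eqP => [[zA za]|->].
      by apply/esym/(p_disj aA zA za); rewrite mem_head.
    by rewrite mem_head.
  - apply/setP=> z; rewrite !inE -in_cons; apply/andP/eqP => [[zB]|->].
      exact: p_beta.
    by rewrite mem_last p_end.
split=> //.
- split=> [E|C /btw[x [y [? _ _]]]]; last by exists x, y.
  rewrite inE => /exists_inP[a aA Ea].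
  have [k ltk ->] := edges_path_graphP _ _ _ Ea.
  exists (nth a (a :: p a) k), (nth a (a :: p a) k.+1); split=> //.
  + by have /pathP := p_path aA; apply.
  + by rewrite inE; apply/exists_inP; exists a => //; rewrite mem_nth //=; lia.
  + by rewrite inE; apply/exists_inP; exists a => //; rewrite mem_nth //=; lia.
- apply/subsetP=> a aA; rewrite inE; apply/exists_inP.
  by exists a => //; rewrite mem_head.
- apply/subsetP=> b /beta_cover[a aA ba].
  by rewrite inE; apply/exists_inP; exists a.
Qed.

End PathFamily.

(* The orbits of sg, cut just before they return from beta to alpha. *)
Lemma perm_linkage (T : finType) (G : sgraph T) (alpha beta : {set T})
    (sg : {perm T}) :
  sg @: beta = alpha ->
  (forall x, x \notin beta -> sg x = x \/ adj G x (sg x)) ->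
  exists2 Q, ab_linkage G alpha beta Q &
    forall x, x \in verts Q -> x \notin beta -> [set x; sg x] \in edges Q.
Proof.
move=> sg_ab sg_adj; have sgI : injective sg by apply: perm_inj.
have back x : sg x \in alpha -> x \in beta.
  by rewrite -sg_ab => /imsetP[b bB /sgI->].
have [k kP] : exists k : T -> nat, forall a, a \in alpha ->
    iter (k a) sg a \in beta /\ forall j, j < k a -> iter j sg a \notin beta.
  apply: (@fin_all_exists _ _ (fun a k => a \in alpha ->
    iter k sg a \in beta /\ forall j, j < k -> iter j sg a \notin beta)) => a.
  have [aA|/negP naA] := boolP (a \in alpha); last by exists 0.
  (* As [a = sg b] for some [b] in [beta], the orbit of [a] comes back to [b]. The least exponent
     that reaches [beta] is where the orbit is cut. *)
  have ex_k : exists k, iter k sg a \in beta.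
    move: aA; rewrite -sg_ab => /imsetP[b bB ->]; exists (findex sg (sg b) b).
    by rewrite iter_findex // fconnect_sym // fconnect1.
  case: (ex_minnP ex_k) => k kB kmin; exists k => _; split=> // j ltj.
  by apply/negP => /kmin; lia.
pose p a := traject sg (sg a) (k a).
have pE a : a :: p a = traject sg a (k a).+1 by [].
(* Cancelling [i] steps gives [a = iter (j - i) sg a']. If [j - i] were positive, the vertex just
   before [a] would lie in [beta], although the segment of [a'] meets [beta] only at step [k a']. *)
have disj a a' i j : a \in alpha -> a' \in alpha -> i <= j -> j <= k a' ->
    iter i sg a = iter j sg a' -> a = a'.
  move=> aA a'A leij lej; rewrite -(subnKC leij) iterD.
  have iterI : injective (iter i sg) by elim: (i) => //= m IH x y /sgI/IH.
  move/iterI; case: (j - i) (leq_subr i j) => // d ltd eq_a.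
  have dB : iter d sg a' \in beta by apply: back; rewrite -iterS -eq_a.
  by have [_ /(_ d)] := kP a' a'A; rewrite dB => lt_d; have:= lt_d ltac:(lia).
have p_disj a a' x : a \in alpha -> a' \in alpha ->
    x \in a :: p a -> x \in a' :: p a' -> a = a'.
  move=> aA a'A; rewrite !pE => /trajectP[i lti ->] /trajectP[j ltj eij].
  have [leij|/ltnW leji] := leqP i j; first exact: disj eij.
  by apply/esym; apply: disj (esym eij).
have p_last a : last a (p a) = iter (k a) sg a by rewrite last_traject.
have p_end a : a \in alpha -> last a (p a) \in beta.
  by move=> aA; rewrite p_last; have [] := kP a aA.
have p_beta a b : a \in alpha -> b \in beta -> b \in a :: p a ->
    b = last a (p a).
  move=> aA bB; rewrite p_last pE => /trajectP[i lti def_b].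
  have [ltik|geik] := ltnP i (k a).
    by have [_ /(_ i ltik)] := kP a aA; rewrite -def_b bB.
  by rewrite def_b; congr iter; lia.
exists (path_family alpha p); last first.
  move=> x; rewrite !inE => /exists_inP[a aA xa] xB.
  apply/exists_inP; exists a => //; apply/edges_path_graphP.
  move: xa; rewrite pE => /trajectP[i lti def_x].
  have ltik : i < k a.
    have [//|geik] := ltnP i (k a); have ei : i = k a by lia.
    by rewrite def_x ei -p_last p_end in xB.
  exists i; first by rewrite size_traject.
  by rewrite !nth_traject //= def_x.
apply: path_family_linkage => //.
- move=> a aA; rewrite pE looping_uniq; apply/negP => /trajectP[i lti eik].
  by have [] := kP a aA; rewrite eik => iB /(_ i lti); rewrite iB.
- move=> a aA; apply/(pathP a) => i; rewrite size_traject => lti.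
  have nthE j : j <= k a -> nth a (a :: p a) j = iter j sg a.
    by move=> lej; rewrite pE nth_traject.
  rewrite -[nth a (p a) i]/(nth a (a :: p a) i.+1) !nthE // ?(ltnW lti) //.
  have [kB /(_ i lti) iB] := kP a aA.
  (* A fixed iterate would equal all later ones, among them the iterate at [k a], which lies in
     [beta]. *)
  case: (sg_adj _ iB) => // fix_i; case/negP: iB.
  have -> // : iter i sg a = iter (k a) sg a.
  rewrite -(subnK (ltnW lti)) iterD.
  by elim: (k a - i) => //= d <-.
(* The ends of the segments are distinct elements of [beta], and [alpha], being the image of [beta]
   under [sg], has as many elements as [beta]; hence the ends exhaust [beta]. *)
- have last_inj : {in alpha &, injective (fun a => last a (p a))}.
    move=> a a' aA a'A /= e; apply: (p_disj a a' (last a (p a))) => //.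
      exact: mem_last.
    by rewrite e mem_last.
  have eqB : [set last a (p a) | a in alpha] = beta.
    apply/eqP; rewrite eqEcard card_in_imset // -sg_ab card_imset //.
    rewrite leqnn andbT.
    by apply/subsetP => _ /imsetP[a aA ->]; rewrite p_end // -sg_ab.
  move=> b; rewrite -eqB => /imsetP[a aA ->].
  by exists a => //; apply: mem_last.
Qed.

(** * The permutation that follows a rigid linkage *)

(** The case [k = size p] is the wrap-around: [nth a p k] is then the default value [a], the head of
    the cycle. *)
Lemma next_nth_uniq (T : eqType) (a : T) (p : seq T) (k : nat) :
  uniq (a :: p) -> k <= size p ->
  next (a :: p) (nth a (a :: p) k) = nth a p k.
Proof.
by move=> up lek; rewrite next_nth mem_nth ?ltnS // index_uniq.
Qed.

Lemma sub_adjP (T : finType) (G : sgraph T) (H : subgraph T) (x y : T) :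
  subgraph_of G H -> sub_adj H x y ->
  [/\ adj G x y, x \in verts H & y \in verts H].
Proof.
move=> sGH /sGH[u [v [Guv uH vH Exy]]].
have xE : x \in [set u; v] by rewrite -Exy !inE eqxx.
have yE : y \in [set u; v] by rewrite -Exy !inE eqxx orbT.
have uE : u \in [set x; y] by rewrite Exy !inE eqxx.
have vE : v \in [set x; y] by rewrite Exy !inE eqxx orbT.
(* In the two cases that match [x] and [y] to the same endpoint, [u = v], which irreflexivity of
   [adj G] excludes. *)
move: xE yE uE vE; rewrite !inE => /orP[]/eqP-> /orP[]/eqP->; rewrite ?orbb.
- by move=> _ /eqP Evu; rewrite Evu adj_irr in Guv.
- by split.
- by rewrite adj_sym; split.
- by move=> /eqP Euv; rewrite Euv adj_irr in Guv.
Qed.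

(** The image of the [i]-th vertex is one of its neighbours on the path. Going back is impossible:
    the first vertex [a] is excluded as a value, and any other predecessor is already, by induction,
    the image of the vertex before it, so injectivity applies. *)
Lemma injective_along_path (T : finType) (f : T -> T) (a : T) (p : seq T) :
  injective f -> uniq (a :: p) ->
  (forall i, i < size p ->
    [/\ f (nth a (a :: p) i) != nth a (a :: p) i, f (nth a (a :: p) i) != a &
      exists2 j, j < size p & [set nth a (a :: p) i; f (nth a (a :: p) i)] =
        [set nth a (a :: p) j; nth a (a :: p) j.+1]]) ->
  forall i, i < size p -> f (nth a (a :: p) i) = nth a (a :: p) i.+1.
Proof.
move=> fI up fP; set s := nth a (a :: p) in fP *.
have sI i j : i <= size p -> j <= size p -> s i = s j -> i = j.
  by move=> lei lej /eqP; rewrite nth_uniq //= => /eqP.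
elim/ltn_ind=> i IH lti; have [fs_neq fs_a [j ltj Es]] := fP i lti.
have: s i \in [set s j; s j.+1] by rewrite -Es !inE eqxx.
have: f (s i) \in [set s j; s j.+1] by rewrite -Es !inE eqxx orbT.
have lei := ltnW lti; have lej := ltnW ltj.
rewrite !inE => /orP[]/eqP fsi /orP[]/eqP si.
- by rewrite fsi si eqxx in fs_neq.
- have def_i : i = j.+1 by apply: sI.
  case: j => [|j] in ltj lej fsi si def_i {Es}.
    by rewrite fsi eqxx in fs_a.
  have ej : f (s j) = s j.+1 by apply: IH; rewrite ?def_i // ltnW.
  have /fI/sI : f (s i) = f (s j) by rewrite ej.
  by rewrite def_i; lia.
- by rewrite fsi; congr s; apply/esym/(congr1 succn)/sI.
- by rewrite fsi si eqxx in fs_neq.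
Qed.

(* tau advances one step along each path of P and sends its end in beta back
   to its start in alpha. *)
Lemma rigid_linkage_shift (T : finType) (G : sgraph T) (alpha beta : {set T})
    (P : subgraph T) :
  ab_rigid G alpha beta P ->
  [/\ beta \subset verts P, #|beta| <= linkage_order P &
  exists tau : {perm T},
    [/\ forall x, x \notin verts P -> tau x = x,
        forall x, x \in verts P -> x \notin beta -> adj G x (tau x) &
        forall sg : {perm T}, {in beta, sg =1 tau} ->
          (forall x, x \notin beta -> sg x = x \/ adj G x (sg x)) ->
          {in verts P, sg =1 tau}]].
Proof.
case=> [[[sGP _] alphaW betaW compP]] uniqP.
pose comp x := [set y | connect (sub_adj P) x y].
have compW x : x \in verts P -> comp x \in components P by apply: imset_f.
have mem_comp x : x \in comp x by rewrite inE connect0.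
have comp_eq x y : y \in comp x -> comp y = comp x.
  rewrite inE => xy; apply/setP=> z; rewrite !inE.
  by rewrite (same_connect (sym_connect_sym (@sub_adj_sym _ P)) xy).
have comp_sub x : x \in verts P -> comp x \subset verts P.
  move=> xW; apply/subsetP => y; rewrite inE => /connectP[q + ->].
  elim: q x xW => //= z q IH x xW /andP[xz]; apply: IH.
  by have [] := sub_adjP sGP xz.
(* [s C] lists the component [C] along its path, from [alpha] to [beta]; sets that are not
   components get the empty list. *)
have [s sP] : exists s : {set T} -> seq T, forall C, C \in components P ->
    exists a p, s C = a :: p /\ [/\ uniq (a :: p), induced P C = path_graph a p,
      alpha :&: C = [set a] & beta :&: C = [set last a p]].
  apply: (@fin_all_exists _ _ (fun C s => C \in components P ->
    exists a p, s = a :: p /\ [/\ uniq (a :: p), induced P C = path_graph a p,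
      alpha :&: C = [set a] & beta :&: C = [set last a p]])) => C.
  have [CP|_] := boolP (C \in components P); last by exists [::].
  have [x [y [[p [up <- eP]] eA eB]]] := compP C CP.
  by exists (x :: p) => _; exists x, p.
have sW x : x \in verts P -> exists a p, [/\ s (comp x) = a :: p,
    [/\ uniq (a :: p), a :: p =i comp x, a \in alpha & last a p \in beta],
    forall y, y \in comp x -> y \in alpha -> y = a,
    forall y, y \in comp x -> y \in beta -> y = last a p &
    forall u v, u \in comp x -> v \in comp x ->
      sub_adj P u v <-> exists2 k, k < size p &
        [set u; v] = [set nth a (a :: p) k; nth a (a :: p) k.+1]].
  move=> xW; have [a [p [-> [up eP eA eB]]]] := sP _ (compW x xW).
  exists a, p; split=> //.
  - split=> //.
    + move=> y; have := congr1 (fun H => y \in verts H) eP.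
      rewrite /= !inE -!in_cons => <-; apply/esym.
      have [yC|_] := boolP (connect (sub_adj P) x y); last by rewrite andbF.
      by rewrite (subsetP (comp_sub x xW)) ?inE.
    + by have := set11 a; rewrite -eA inE => /andP[].
    + by have := set11 (last a p); rewrite -eB inE => /andP[].
  - by move=> y yC yA; apply/set1P; rewrite -eA inE yA.
  - by move=> y yC yB; apply/set1P; rewrite -eB inE yB.
  move=> u v uC vC; have -> : sub_adj P u v =
      ([set u; v] \in edges (path_graph a p)).
    rewrite -eP inE /sub_adj; case: (_ \in _) => //=.
    by rewrite subUset !sub1set uC vC.
  by apply: iff_sym; apply: rwP; apply: edges_path_graphP.
pose cyc x := s (comp x).
(* [next] is cyclic, so the last vertex of a list, its only one in [beta], goes to the head, its
   only one in [alpha]. *)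
pose shift x := if x \in verts P then next (cyc x) x else x.
have cycE x : x \in verts P -> cyc x =i comp x.
  by move=> xW; rewrite /cyc; have [a [p [-> []]]] := sW x xW.
have shift_comp x : x \in verts P -> shift x \in comp x.
  by move=> xW; rewrite /shift xW -cycE // mem_next cycE.
(* [shift] stays inside each component, where it is inverted by [prev] on the duplicate-free list of
   that component. *)
have shift_inj : injective shift.
  have shift_W x : (shift x \in verts P) = (x \in verts P).
    have [xW|xW] := boolP (x \in verts P); last by rewrite /shift !(negPf xW).
    exact: subsetP (comp_sub x xW) _ (shift_comp x xW).
  move=> x y exy; have [xW|xW] := boolP (x \in verts P); last first.
    have yW : y \notin verts P by rewrite -shift_W -exy shift_W.
    by move: exy; rewrite /shift (negPf xW) (negPf yW).
  have yW : y \in verts P by rewrite -shift_W -exy shift_W.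
  have exyC : comp x = comp y.
    by rewrite -(comp_eq _ _ (shift_comp x xW)) exy; apply/comp_eq/shift_comp.
  move: exy; rewrite /shift xW yW /cyc exyC.
  by have [a [p [-> [up _ _ _] _ _ _]]] := sW y yW;
    apply: can_inj (prev_next up) _ _.
have shift_nth x : x \in verts P -> x \notin beta -> exists a p k,
    [/\ s (comp x) = a :: p, k < size p, x = nth a (a :: p) k &
        shift x = nth a (a :: p) k.+1].
  move=> xW xB; have [a [p [e_s [up pE aA bB] _ _ _]]] := sW x xW.
  have: x \in a :: p by rewrite pE.
  case/(nthP a) => k; rewrite ltnS => lek def_x; exists a, p, k.
  have ltk : k < size p.
    rewrite ltn_neqAle lek andbT; apply: contraNneq xB => ek.
    by rewrite -def_x ek nth_last /= bB.
  by split=> //; rewrite /shift xW /cyc e_s -def_x next_nth_uniq.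
pose tau := perm shift_inj.
have tau_img : tau @: beta = alpha.
  apply/setP=> y; apply/imsetP/idP => [[b bB ->]|yA].
    have bW := subsetP betaW _ bB; rewrite permE /shift bW /cyc.
    have [a [p [-> [up _ aA _] _ /(_ b (mem_comp b) bB)-> _]]] := sW b bW.
    by rewrite (last_nth a) next_nth_uniq // nth_default.
  have yW := subsetP alphaW _ yA.
  have [a [p [e_s [up pE _ bB] /(_ y (mem_comp y) yA) ey _ _]]] := sW y yW.
  have bC : last a p \in comp y by rewrite -pE mem_last.
  exists (last a p) => //; rewrite permE /shift (subsetP betaW _ bB) /cyc.
  by rewrite (comp_eq _ _ bC) e_s (last_nth a) next_nth_uniq // nth_default.
split=> //.
  (* A component meets [beta] in one vertex only, so [comp] is injective on [beta]. *)
  rewrite /linkage_order -(@card_in_imset _ _ comp).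
    apply/subset_leq_card/subsetP => _ /imsetP[b bB ->].
    exact/compW/(subsetP betaW).
  move=> b b' bB b'B ebb'.
  have [a [p [_ _ _ lastP _]]] := sW b (subsetP betaW _ bB).
  by rewrite (lastP b) // (lastP b') // ebb'.
exists tau; split.
- by move=> x xW; rewrite permE /shift (negPf xW).
- move=> x xW xB; rewrite permE.
  have [a [p [k [e_s ltk ex es]]]] := shift_nth x xW xB.
  have [a' [p' []]] := sW x xW; rewrite e_s => -[<- <-] _ _ _ edgeP.
  suff /(sub_adjP sGP)[] : sub_adj P x (shift x) by [].
  apply/(edgeP _ _ (mem_comp x) (shift_comp x xW)).
  by exists k; rewrite // -ex -es.
move=> sg sg_tau sg_adj.
have sg_img : sg @: beta = alpha.
  by rewrite -tau_img; apply: eq_in_imset.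
(* By rigidity the linkage cut from the orbits of [sg] is [P], so [sg] moves each vertex of [P]
   outside [beta] along an edge of [P]. *)
have [Q QL Qedge] := perm_linkage sg_img sg_adj.
move: Qedge; rewrite (uniqP Q QL) => Pedge {Q QL} x xW.
have [xB|xB] := boolP (x \in beta); first exact: sg_tau.
have [a [p [k [e_s ltk ex es]]]] := shift_nth x xW xB.
rewrite permE es.
have [a' [p' []]] := sW x xW.
rewrite e_s => -[<- <-] [up pE aA _] _ lastP edgeP {a' p'}.
rewrite ex.
have nthI i j : i <= size p -> j <= size p ->
    nth a (a :: p) i = nth a (a :: p) j -> i = j.
  by move=> lei lej /eqP; rewrite nth_uniq //= => /eqP.
(* Before its end the path has no vertex in [beta]. There [sg] has no fixed point, and it cannot
   take the value [a], since only elements of [beta] are sent into [alpha]. *)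
apply: injective_along_path ltk => // [|i lti]; first exact: perm_inj.
set y := nth a _ i.
have yC : y \in comp x by rewrite -pE mem_nth //= ltnW.
have yW := subsetP (comp_sub x xW) _ yC.
have yB : y \notin beta.
  apply/negP => /(lastP y yC); rewrite (last_nth a).
  move/(nthI _ _ (ltnW lti) (leqnn _)).
  by move=> ei; rewrite ei ltnn in lti.
have Py : sub_adj P y (sg y) by apply: Pedge.
have sgC : sg y \in comp x by rewrite -(comp_eq _ _ yC) inE connect1.
split.
- by have [+ _ _] := sub_adjP sGP Py; apply: contraTneq => ->; rewrite adj_irr.
- apply: contraNneq yB => sgy; have : sg y \in sg @: beta by rewrite sg_img sgy.
  by case/imsetP=> b bB /perm_inj->.
- exact/(edgeP _ _ yC sgC).
Qed.

(** * Rank bounds for matrices over a field *)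

Import GRing.Theory.

Local Open Scope ring_scope.

Lemma mxrank_leq_support (F : fieldType) (m n : nat) (M : 'M[F]_(m, n))
    (Z : {set 'I_m}) :
  (forall i j, i \notin Z -> M i j = 0) -> (\rank M <= #|Z|)%N.
Proof.
move=> M0; suff /mxrankS/leq_trans : (M <= rowsub (@enum_val _ (mem Z)) M)%MS.
  by apply; apply: rank_leq_row.
apply/row_subP => i; have [iZ|iZ] := boolP (i \in Z); last first.
  suff -> : row i M = 0 by apply: sub0mx.
  by apply/rowP => j; rewrite !mxE M0.
rewrite -(enum_rankK_in iZ iZ) -row_rowsub; exact: row_sub.
Qed.

(** [f] selects a maximal independent set of rows. By symmetry the columns with the same indices
    span the column space, so the selected rows factor through the principal submatrix, which
    therefore has full rank. *)
Lemma sym_principal_unitmx (F : fieldType) (m : nat) (M : 'M[F]_m) :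
  M^T = M -> exists2 f : 'I_(\rank M) -> 'I_m,
    injective f & mxsub f f M \in unitmx.
Proof.
move=> symM; pose f := maxrankfun M; exists f; first exact: maxrankfun_inj.
have /submxP[X MX] : (M <= rowsub f M)%MS by rewrite eq_maxrowsub.
rewrite -unitmx_tr -row_free_unit /row_free eqn_leq rank_leq_row /=.
apply: (@leq_trans (\rank (rowsub f M))); first by rewrite eq_maxrowsub.
have MXt : M = (rowsub f M)^T *m X^T by rewrite -trmx_mul -MX symM.
have -> : rowsub f M = (mxsub f f M)^T *m X^T.
  rewrite [LHS](congr1 (rowsub f) MXt) -mul_rowsub_mx; congr (_ *m _).
  by apply/matrixP => i j; rewrite !mxE.
exact: mxrankM_maxl.
Qed.

(** The rank estimate with the graph removed: nonzero entries of [A] stand for edges, the last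
    hypothesis stands for rigidity, and [g] enumerates the index set of the nonsingular block. Fixed
    points of [sg] are allowed because of the unit rows of [B]. *)
Lemma rank_unique_shift (F : fieldType) (n r : nat) (A : 'M[F]_n)
    (beta W : {set 'I_n}) (tau : {perm 'I_n}) (g : 'I_r -> 'I_n) :
  injective g -> (forall k, g k \notin W) -> mxsub g g A \in unitmx ->
  beta \subset W ->
  (forall x, x \notin W -> tau x = x) ->
  (forall x, x \in W -> x \notin beta -> A x (tau x) != 0) ->
  (forall sg : {perm 'I_n}, {in beta, sg =1 tau} ->
    (forall x, x \notin beta -> sg x = x \/ A x (sg x) != 0) ->
    {in W, sg =1 tau}) ->
  (#|W| + r <= \rank A + #|beta|)%N.
Proof.
move=> gI gW unitA betaW tau_out tau_in rigid.
pose S := [set g k | k in 'I_r]; pose U := W :|: S.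
have disjWS : [disjoint W & S].
  rewrite disjoint_sym disjoint_subset; apply/subsetP => _ /imsetP[k _ ->].
  exact: gW.
pose B := \matrix_(i, j) if i \in beta then (j == tau i)%:R else
  if i \in U then A i j else (i == j)%:R : F.
(* [B'] keeps the entries of [B] at [(i, tau i)] for [i] in [W] and those with both indices outside
   [W]. *)
pose B' := \matrix_(i, j)
  if (if i \in W then j == tau i else j \notin W) then B i j else 0.
(* The Leibniz expansions agree term by term: a zero factor in [B] is also zero in [B'], and a
   permutation without zero factors uses only entries that [B'] keeps. *)
have detBB' : \det B = \det B'.
  apply: eq_bigr => sg _; congr (_ * _).
  have [/forallP Bn0|] := boolP [forall i, B i (sg i) != 0]; last first.
    case/forallPn => i /negbNE/eqP Bi0.
    by rewrite (bigD1 i) //= [RHS](bigD1 i) //= [B' _ _]mxE Bi0 if_same !mul0r.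
  have sg_beta : {in beta, sg =1 tau}.
    move=> i iB; have := Bn0 i; rewrite mxE iB.
    by have [//|_] := eqVneq (sg i) (tau i); rewrite eqxx.
  have sgW : {in W, sg =1 tau}.
    apply: rigid => // i iB; have := Bn0 i; rewrite mxE (negPf iB).
    case: ifP => _; first by right.
    by have [<-|_] := eqVneq i (sg i); [left | rewrite eqxx].
  (* [tau] permutes [W], so [sg], which agrees with it there, already covers [W] from [W]; nothing
     outside can be sent into [W]. *)
  have sgWE i : (sg i \in W) = (i \in W).
    have tauWE j : (tau j \in W) = (j \in W).
      have [jW|jW] := boolP (j \in W); last by rewrite tau_out // (negPf jW).
      apply: contraT => tjW; case/negP: (tjW).
      by have /perm_inj-> := tau_out _ tjW.
    have [iW|iW] := boolP (i \in W); first by rewrite sgW // tauWE.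
    apply: contraNF iW => iW.
    have kW : (tau^-1)%g (sg i) \in W by rewrite -tauWE permKV.
    have := sgW _ kW; rewrite permKV => /perm_inj ki.
    by rewrite -ki.
  apply: eq_bigr => i _; rewrite [B' _ _]mxE sgWE.
  by have [iW|//] := boolP (i \in W); rewrite sgW // eqxx.
have unitB' : B' \in unitmx.
  (* A kernel vector [v] of [B'] vanishes on [W] by the monomial rows, then outside [U] by the unit
     rows, and finally on [S] because only the nonsingular block remains. *)
  rewrite -unitmx_tr -row_free_unit; apply: inj_row_free => v vB'0.
  have E i : \sum_j v 0 j * B' i j = 0.
    have /rowP/(_ i) := vB'0; rewrite !mxE => {2}<-.
    by apply: eq_bigr => j _; rewrite [in RHS]mxE.
  have vW y : y \in W -> v 0 y = 0.
    move=> yW; pose x := (tau^-1)%g y; have tx : tau x = y by rewrite permKV.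
    have xW : x \in W.
      by apply: contraLR yW => xW; rewrite -tx tau_out.
    have Bxy : B x y != 0.
      rewrite mxE -tx eqxx; case: ifP => [_|/negbT xB]; first exact: oner_neq0.
      by rewrite inE xW /= tau_in.
    have := E x; rewrite (bigD1 y) //= big1 => [|j jy]; last first.
      by rewrite [B' _ _]mxE xW tx (negPf jy) mulr0.
    rewrite addr0 [B' _ _]mxE xW tx eqxx => /eqP.
    by rewrite mulf_eq0 (negPf Bxy) orbF => /eqP.
  have vU i : i \notin U -> v 0 i = 0.
    move=> iU; have iW : i \notin W by apply: contraNN iU; rewrite inE => ->.
    have iB : i \notin beta by apply: contraNN iW; apply/subsetP.
    have := E i; rewrite (bigD1 i) //= big1 => [|j ji]; last first.
      rewrite [B' _ _]mxE [B _ _]mxE (negPf iW) (negPf iB) (negPf iU).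
      by rewrite eq_sym (negPf ji) if_same mulr0.
    rewrite [B' _ _]mxE [B _ _]mxE (negPf iW) (negPf iB) (negPf iU) eqxx.
    by rewrite mulr1 addr0.
  have vS k : v 0 (g k) = 0.
    suff /rowP/(_ k) : \row_k v 0 (g k) = 0 by rewrite !mxE.
    have unitAt : (mxsub g g A)^T \in unitmx by rewrite unitmx_tr.
    apply: (can_inj (mulmxK unitAt)).
    rewrite mul0mx; apply/rowP => l; rewrite !mxE -[RHS](E (g l)).
    rewrite [RHS](bigID (mem S)) /= [X in _ = _ + X]big1 ?addr0; last first.
      move=> j jS; have [jW|jW] := boolP (j \in W); first by rewrite vW ?mul0r.
      by rewrite vU ?mul0r // inE negb_or jW.
    rewrite big_imset /=; last by move=> ? ? _ _; apply: gI.
    apply: eq_bigr => k' _; rewrite !mxE (negPf (gW l)) gW.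
    have -> : g l \in beta = false.
      by apply: contraNF (gW l); apply/subsetP.
    by rewrite inE imset_f ?orbT.
  apply/rowP => i; rewrite [RHS]mxE; have [iU|/vU//] := boolP (i \in U).
  by case/setUP: iU => [/vW//|/imsetP[k _ ->]].
have rankB : \rank B = n.
  by apply: mxrank_unit; rewrite unitmxE detBB' -unitmxE.
have rankBA : (\rank (B - A)%R <= #|beta :|: ~: U|)%N.
  apply: mxrank_leq_support => i j; rewrite inE negb_or in_setC negbK.
  by case/andP=> iB iU; rewrite !mxE (negPf iB) iU subrr.
have := mxrank_add A (B - A); rewrite addrC subrK rankB => le_n.
have le_card := leq_of_leqif (leq_card_setU beta (~: U)).
have cardU : #|U| = (#|W| + r)%N.
  rewrite cardsU; have /eqP-> : W :&: S == set0 by rewrite setI_eq0.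
  rewrite cards0 subn0.
  by rewrite card_imset // card_ord.
have := cardsC U; rewrite card_ord; lia.
Qed.

(** * From rank to nullity *)

Unset Implicit Arguments.

Theorem theorem3p4 (R : realType) (n t : nat) (G : sgraph 'I_n)
    (alpha beta : {set 'I_n}) (P : subgraph 'I_n) (A : 'M[R]_n) :
  ab_rigid G alpha beta P ->
  linkage_order P = t ->
  matrices_of_graph G A ->
  (nullity A)%:Z - t%:Z <= (nullity (principal_del A (verts P)))%:Z.
Proof.
move=> rigidP <- [symA A_G].
have [betaW le_beta [tau [tau_out tau_in tau_uniq]]] :=
  rigid_linkage_shift rigidP.
set M := principal_del A (verts P).
have symM : M^T = M by apply/matrixP => i j; rewrite !mxE -{1}symA mxE.
have [f fI unitM] := sym_principal_unitmx symM.
pose g k := enum_val (f k).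
have leA : (#|verts P| + \rank M <= \rank A + #|beta|)%N.
  apply: (@rank_unique_shift _ _ _ _ _ _ tau g) => //.
  - by move=> k l /enum_val_inj/fI.
  - by move=> k; have := enum_valP (f k); rewrite inE.
  - suff -> : mxsub g g A = mxsub f f M by [].
    by apply/matrixP => i j; rewrite !mxE.
  - move=> x xW xB; have adjx := tau_in x xW xB; rewrite A_G //.
    by apply: contraTneq adjx => <-; rewrite adj_irr.
  (* A nonzero entry of [A] at [(x, sg x)] is an edge only off the diagonal; on the diagonal [sg]
     fixes [x]. *)
  - move=> sg sg_beta sg_A; apply: (tau_uniq sg sg_beta) => x xB.
    have [|sg_x] := eqVneq (sg x) x; first by left.
    case: (sg_A x xB) => [|Ax]; first by left.
    by right; rewrite -A_G // eq_sym.
(* Each nullity is a size minus a rank, truncated in [nat]; the rank bounds make these subtractions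
   exact. *)
have := cardsC (verts P); rewrite card_ord.
have := rank_leq_row M; have := rank_leq_row A.
rewrite /nullity !mxrank_coker -/M.
lia.
Qed.
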